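(* Let $(V,E,d)$ be a multi-weighted game graph and $v_0\in V$. If Player 1 wins the bounding game $\Gamma(V,E,d)$ from $v_0$, then she has a strategy winning from $v_0$ which ensures $$\|\rho\|\le(4|V|\cdot\|E\|)^{2(d+2)^3}$$ for all plays $\rho$ from $v_0$ consistent with it.
   Context: A multi-weighted game graph is a tuple $(V,E,d)$ where $d\in\mathbb N$ is the dimension, $V=V_1\uplus V_2$ is a finite set of vertices partitioned into Player-1 vertices $V_1$ and Player-2 vertices $V_2$, and $E\subseteq V\times\mathbb Z^d\times V$ is a finite set of edges such that every vertex has at least one outgoing edge. For $\mathbf a\in\mathbb Z^d$, $\|\mathbf a\|=\max_i|\mathbf a(i)|$, and $\|E\|=\max_{(v,\mathbf u,v')\in E}\|\mathbf u\|$. Standing assumptions: $\|E\|>0$, and every cycle of the graph contains at least one Player-1 vertex. A path is a finite sequence $(v_0,\mathbf a_0)\cdots(v_n,\mathbf a_n)$ in $V\times\mathbb Z^d$ with $(v_j,\mathbf a_{j+1}-\mathbf a_j,v_{j+1})\in E$ for all $0\le j<n$. A play from $v_0$ is an infinite sequence $\rho=(v_0,\mathbf a_0)(v_1,\mathbf a_1)\cdots$ with $\mathbf a_0=\mathbf 0$ all of whose finite prefixes $\rho|_n=(v_0,\mathbf a_0)\cdots(v_n,\mathbf a_n)$ are paths; $w(\rho|_n)=\mathbf a_n$. The norm of a play is $\|\rho\|=\sup_n\|w(\rho|_n)\|$. A strategy of Player $p$ maps each non-empty path ending in a vertex $v\in V_p$ to an edge of $E$ leaving $v$; a play is consistent with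 it if Player $p$'s moves follow it. In the bounding game $\Gamma(V,E,d)$, a play $\rho$ is winning for Player 1 if $\|\rho\|<\infty$, and winning for Player 2 otherwise. A player wins from $v_0$ if he or she has a strategy such that all consistent plays from $v_0$ are winning for that player. *)

(* Defs.v *)
From mathcomp Require Import all_boot all_order all_algebra finmap.
From mathcomp Require Import boolp classical_sets constructive_ereal.

Set Implicit Arguments.
Unset Strict Implicit.
Unset Printing Implicit Defensive.

Import Order.TTheory GRing.Theory Num.Theory.

Local Open Scope ring_scope.

Definition vnorm (d : nat) (a : 'rV[int]_d) : nat := \max_(i < d) `|a ord0 i|%N.

(* The vertices of Player 2 are the complement of [vertices1]. *)
Record game_graph (d : nat) := GameGraph {
  vertex :> finType;
  vertices1 : {set vertex};
  edges : {fset vertex * 'rV[int]_d * vertex};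
  edges_total : forall v : vertex, exists u v', (v, u, v') \in edges }.

Inductive player := Player1 | Player2.

Section Game.
Context (d : nat) (G : game_graph d).

Definition vertices (p : player) : {set G} :=
  match p with Player1 => vertices1 G | Player2 => ~: vertices1 G end.

Definition edge : Type := (G * 'rV[int]_d * G)%type.

Definition enorm : nat := \max_(e <- edges G) vnorm e.1.2.

Definition adjacent : rel G :=
  fun v v' => has (fun e => (e.1.1 == v) && (e.2 == v')) (edges G).

Definition cycles_meet_player1 : Prop :=
  forall c : seq G, c != [::] -> cycle adjacent c ->
    exists2 v, v \in c & v \in vertices Player1.

Definition config : Type := (G * 'rV[int]_d)%type.

Definition step (c c' : config) : edge := (c.1, c'.2 - c.2, c'.1).

Definition is_path (s : seq config) : bool :=
  (s != [::]) && sorted (fun c c' => step c c' \in edges G) s.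

Definition play_prefix (rho : nat -> config) (n : nat) : seq config :=
  mkseq rho n.+1.

Definition weight (s : seq config) : 'rV[int]_d := last 0 [seq c.2 | c <- s].

Definition play_from (v0 : G) (rho : nat -> config) : Prop :=
  rho 0%N = (v0, 0) /\ forall n, is_path (play_prefix rho n).

(* The supremum is taken in the integers extended with infinities, hence is
   +oo exactly when the weights are unbounded (see [play_norm_lty]). *)
Definition play_norm (rho : nat -> config) : \bar int :=
  supremum -oo%E
    [set ((vnorm (weight (play_prefix rho n)))%:Z)%:E | n in [set: nat]]%classic.

(* A strategy is represented by a total function; its values outside of
   [is_path] sequences ending in a vertex of [p] are irrelevant. *)
Definition strategy (p : player) (sigma : seq config -> edge) : Prop :=
  forall s c, is_path (rcons s c) -> c.1 \in vertices p ->
    sigma (rcons s c) \in edges G /\ (sigma (rcons s c)).1.1 = c.1.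

Definition consistent (p : player) (sigma : seq config -> edge)
    (rho : nat -> config) : Prop :=
  forall n, (rho n).1 \in vertices p ->
    step (rho n) (rho n.+1) = sigma (play_prefix rho n).

Definition winning_play (p : player) (rho : nat -> config) : Prop :=
  match p with
  | Player1 => (play_norm rho < +oo)%E
  | Player2 => ~ (play_norm rho < +oo)%E
  end.

Definition winning_strategy (p : player) (v0 : G)
    (sigma : seq config -> edge) : Prop :=
  strategy p sigma /\
  forall rho, play_from v0 rho -> consistent p sigma rho -> winning_play p rho.

Definition wins (p : player) (v0 : G) : Prop :=
  exists sigma, winning_strategy p v0 sigma.

Lemma weight_prefix (rho : nat -> config) (n : nat) :
  weight (play_prefix rho n) = (rho n).2.
Proof.
rewrite /weight /play_prefix /mkseq -(addn1 n) iotaD map_cat /=.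
by rewrite map_cat last_cat.
Qed.

Lemma play_normP (rho : nat -> config) :
  supremums [set ((vnorm (weight (play_prefix rho n)))%:Z)%:E |
              n in [set: nat]]%classic (play_norm rho).
Proof.
rewrite /play_norm; set A := image _ _.
have A0 : A ((vnorm (weight (play_prefix rho 0)))%:Z)%:E by exists 0%N.
suff [x Ax] : exists x, supremums A x.
  rewrite /supremum ifF; last by apply/negbTE/set0P; exists ((vnorm (weight (play_prefix rho 0)))%:Z)%:E.
  by case: xgetP => [y _ //|/(_ x)].
have nat_of_ub y : ubound A y -> y = +oo%E \/ exists B : nat, y = (B%:Z)%:E.
  move=> ubA; case: y ubA => [r| |] ubA; [right | by left | by have := ubA _ A0].
  exists `|r|%N; rewrite gez0_abs // -lee_fin.
  by apply: le_trans (ubA _ A0); rewrite lee_fin.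
have [exB|nexB] := pselect (exists B : nat, `[< ubound A (B%:Z)%:E >]).
  exists (((ex_minn exB)%:Z)%:E).
  case: ex_minnP => m /asboolP ubm minm; split=> // y uby.
  case: (nat_of_ub y uby) => [->|[B yE]]; first exact: leey.
  by rewrite yE lee_fin lez_nat minm //; apply/asboolP; rewrite -yE.
exists +oo%E; split=> [y _|y uby]; first exact: leey.
case: (nat_of_ub y uby) => [-> //|[B yE]].
by case: nexB; exists B; apply/asboolP; rewrite -yE.
Qed.

Lemma play_norm_le (rho : nat -> config) (B : nat) :
  (play_norm rho <= (B%:Z)%:E)%E <-> forall n, (vnorm (rho n).2 <= B)%N.
Proof.
have [ub lb] := play_normP rho; split=> [le_B n|le_B].
  rewrite -lez_nat -lee_fin -weight_prefix.
  by apply: le_trans le_B; apply: ub; exists n.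
by apply: lb => _ [n _ <-]; rewrite weight_prefix lee_fin lez_nat.
Qed.

Lemma play_norm_lty (rho : nat -> config) :
  (play_norm rho < +oo)%E <->
  exists B : nat, forall n, (vnorm (rho n).2 <= B)%N.
Proof.
split=> [lty|[B /play_norm_le le_B]]; last exact: le_lt_trans le_B (ltry _).
have [ub _] := play_normP rho; move: lty ub.
case: (play_norm rho) => [r _ ub| //|_ ub]; last first.
  by have := ub _ (ex_intro2 _ _ 0%N I erefl).
exists `|r|%N => n; have := ub _ (ex_intro2 _ _ n I erefl).
rewrite weight_prefix lee_fin => le_r.
by rewrite -lez_nat gez0_abs // (le_trans _ le_r).
Qed.

End Game.

(* Main.v *)
Require Import Defs.
From mathcomp Require Import all_boot all_order all_algebra finmap.
From mathcomp Require Import boolp classical_sets constructive_ereal.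
From mathcomp Require Import zify ring.

(* Call a set of configurations safe if Player 1 can keep the play in it. If
   Player 1 wins, she has a safe set [W] of bounded norm containing [(v0, 0)]:
   otherwise, against any strategy of hers, Player 2 could exceed one bound
   after the other while avoiding the vertices from which such a set exists.

   For an integer vector [x], Player 2's moves and at least one move of Player 1
   at each vertex do not decrease the maximum of [x . a] over the slices of [W],
   hence every cycle [c] formed by such moves has [x . c <= 0]. The new safe set
   is modelled on a zonotope: the sum of the segments [-c, c] over all integer
   vectors [c] as large as the weights of simple cycles, scaled up. Its facet
   normals are bounded, and directions along which a configuration leaves the
   zonotope have scalar products of the same sign with every simple cycle. These
   active directions are kept on a stack [u_1 ... u_k] ordered by age, and
   Player 1 uses moves that are good for [x = T^(k-1) u_1 + ... + u_k] with [T]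
   huge; they are good for all prefixes of the stack as well, and keep each [u_i]
   almost non-increasing as long as nothing below [u_i] is removed. A removal
   costs a bounded amount but moves [u_i] down the stack for good. *)

Set Implicit Arguments.
Unset Strict Implicit.
Unset Printing Implicit Defensive.
Import Order.TTheory GRing.Theory Num.Theory.

(** * Zonotopes and their normal directions *)

Section InnerProduct.
Local Open Scope ring_scope.
Context (d : nat).
Implicit Types (u v w : 'rV[int]_d) (k : int).

Definition dot u v : int := \sum_j u ord0 j * v ord0 j.

Lemma dotC u v : dot u v = dot v u.
Proof. by apply: eq_bigr => j _; rewrite mulrC. Qed.

Lemma dotDr u v w : dot u (v + w) = dot u v + dot u w.
Proof. by rewrite -big_split; apply: eq_bigr => j _; rewrite mxE mulrDr. Qed.

Lemma dotZr k u v : dot u (k *: v) = k * dot u v.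
Proof. by rewrite mulr_sumr; apply: eq_bigr => j _; rewrite mxE mulrCA. Qed.

Lemma dotDl u v w : dot (u + v) w = dot u w + dot v w.
Proof. by rewrite !(dotC _ w) dotDr. Qed.

Lemma dotZl k u v : dot (k *: u) v = k * dot u v.
Proof. by rewrite !(dotC _ v) dotZr. Qed.

Lemma dotNr u v : dot u (- v) = - dot u v.
Proof. by rewrite -scaleN1r dotZr mulN1r. Qed.

Lemma dotNl u v : dot (- u) v = - dot u v.
Proof. by rewrite dotC dotNr dotC. Qed.

Lemma dot0r u : dot u 0 = 0.
Proof. by rewrite -(scale0r 0) dotZr mul0r. Qed.

Lemma dot0l u : dot 0 u = 0.
Proof. by rewrite dotC dot0r. Qed.

Definition dotE := (dotDl, dotDr, dotZl, dotZr, dotNl, dotNr, dot0l, dot0r).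

Lemma vnormP u (K : nat) :
  reflect (forall j, (`|u ord0 j| <= K)%N) (vnorm u <= K)%N.
Proof.
apply: (iffP (bigmax_leqP _ _ _)) => [le_K j|le_K j _]; exact: le_K.
Qed.

Lemma vnorm0 : vnorm (0 : 'rV[int]_d) = 0%N.
Proof. by apply/eqP; rewrite -leqn0; apply/vnormP => j; rewrite mxE. Qed.

Lemma vnormD u v : (vnorm (u + v) <= vnorm u + vnorm v)%N.
Proof.
apply/vnormP => j; rewrite mxE.
have /vnormP/(_ j) uj := leqnn (vnorm u).
have /vnormP/(_ j) vj := leqnn (vnorm v).
move: uj vj; set a := u _ _; set b := v _ _.
by set m := vnorm u; set k := vnorm v; lia.
Qed.

Lemma vnormN u : vnorm (- u) = vnorm u.
Proof. by apply: eq_bigr => j _; rewrite mxE abszN. Qed.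

Lemma dot_le u v (K K' : nat) : (vnorm u <= K)%N -> (vnorm v <= K')%N ->
  `|dot u v| <= (d * K * K')%N%:Z.
Proof.
move=> /vnormP uK /vnormP vK; apply: le_trans (ler_norm_sum _ _ _) _.
rewrite (le_trans (ler_sum _ (_ : forall j, _ -> _ <= (K * K')%N%:Z)))//.
  by move=> j _; rewrite normrM -!abszE -PoszM lez_nat leq_mul.
by rewrite sumr_const card_ord -mulr_natl -mulnA PoszM natz.
Qed.

Definition box (K : nat) : seq 'rV[int]_d :=
  undup (codom (fun f : {ffun 'I_d -> 'I_K.*2.+1} =>
                  \row_j ((f j : nat)%:Z - K%:Z))).

Lemma mem_box K u : (u \in box K) = (vnorm u <= K)%N.
Proof.
rewrite mem_undup; apply/codomP/vnormP => [[f ->] j|uK].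
  by rewrite mxE; have := ltn_ord (f j); move: (nat_of_ord (f j)) => n;
    rewrite -muln2; lia.
exists [ffun j => inord `|(u ord0 j + K%:Z)%R|%N].
apply/rowP => j; rewrite mxE ffunE inordK; have := uK j; move: (u _ _) => a;
  rewrite -?muln2; lia.
Qed.

Lemma box_uniq K : uniq (box K). Proof. exact: undup_uniq. Qed.

Lemma size_box K : (size (box K) <= K.*2.+1 ^ d)%N.
Proof.
by apply: leq_trans (size_undup _) _; rewrite size_codom card_ffun !card_ord.
Qed.

End InnerProduct.

Lemma seq_argmin (T : eqType) (f : T -> rat) (s : seq T) x : x \in s ->
  exists2 y, y \in s & all (fun z => f y <= f z)%R s.
Proof.
elim: s x => // x s IH _ _; have [s0|[z zs]] : s = [::] \/ exists z, z \in s.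
- by case: s {IH} => [|z s]; [left | right; exists z; rewrite mem_head].
- by exists x; rewrite ?mem_head//= s0 lexx.
have [y ys ymin] := IH _ zs; have [xy|yx] := leP (f x) (f y).
  exists x; rewrite ?mem_head //= lexx /=.
  by apply: sub_all ymin => t; apply: le_trans.
by exists y; rewrite ?in_cons ?ys ?orbT//= (ltW yx).
Qed.

Section Conformal.
Local Open Scope ring_scope.
Context (d N : nat).
Hypothesis N_gt0 : (0 < N)%N.
Implicit Types (u y r c a : 'rV[int]_d).
Local Notation C := (box d N).

Lemma boxN c : (- c \in C) = (c \in C).
Proof. by rewrite !mem_box vnormN. Qed.

Lemma delta_box j : delta_mx ord0 j \in C.
Proof.
rewrite mem_box; apply/vnormP => i; rewrite mxE.
by case: eqP => //= _; case: eqP.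
Qed.

Lemma dot_delta u j : dot (delta_mx ord0 j) u = u ord0 j.
Proof.
rewrite /dot (bigD1 j) //= big1 ?mxE ?eqxx ?mul1r ?addr0// => i ij.
by rewrite mxE eqxx (negbTE ij) mul0r.
Qed.

Lemma neq0_box u : u != 0 -> exists2 c, c \in C & 0 < dot c u.
Proof.
move=> /eqP u0; have [j uj] : exists j, u ord0 j != 0.
  apply/existsP; apply: contra_notT u0; rewrite negb_exists => /forallP u0.
  by apply/rowP => j; rewrite mxE; apply/eqP; have := u0 j; rewrite negbK.
have [uj0|uj0] := ltrP 0 (u ord0 j).
  by exists (delta_mx ord0 j); rewrite ?delta_box ?dot_delta.
exists (- delta_mx ord0 j); rewrite ?boxN ?delta_box// dotNl dot_delta oppr_gt0.
by rewrite lt_neqAle uj.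
Qed.

(** As [C] is symmetric, [r] lies in the closed face whose relative interior contains [u], for the
    arrangement of hyperplanes orthogonal to [C]. These faces form the normal fan of the
    zonotope. *)
Definition conformal r u := forall c, c \in C -> 0 <= dot c u -> 0 <= dot c r.

Lemma conformal_eq0 r u c :
  conformal r u -> c \in C -> dot c u = 0 -> dot c r = 0.
Proof.
move=> ru cC cu; apply/eqP; rewrite eq_le (ru c)// ?cu// andbT.
by rewrite -oppr_ge0 -dotNl ru ?boxN// dotNl cu oppr0.
Qed.

Lemma conformal_trans r y u : conformal r y -> conformal y u -> conformal r u.
Proof. by move=> ry yu c cC cu; apply: ry => //; apply: yu. Qed.

Definition nonzeros u := count (fun c => dot c u != 0) C.

(* Walking from [u] in the direction [- y] until the first inequality
   [0 <= dot c u] becomes tight. *)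
Lemma conformal_reduce u y :
  (forall c, c \in C -> dot c u = 0 -> dot c y = 0) ->
  (exists2 c, c \in C & (0 < dot c u) && (0 < dot c y)) ->
  exists2 c, c \in C & [/\ 0 < dot c u, 0 < dot c y,
    conformal (dot c y *: u - dot c u *: y) u &
    (nonzeros (dot c y *: u - dot c u *: y) < nonzeros u)%N].
Proof.
move=> zuy [c1 c1C c1p].
pose P c := (0 < dot c u) && (0 < dot c y).
pose ratio c : rat := (dot c u)%:~R / (dot c y)%:~R.
have [c cC /andP[Pc minc]] : exists2 c, c \in C &
    P c && all (fun c' => P c' ==> (ratio c <= ratio c')) C.
  have : c1 \in filter P C by rewrite mem_filter c1C /P c1p.
  case/(seq_argmin ratio) => c; rewrite mem_filter => /andP[Pc cC] /allP cmin.
  exists c; rewrite // Pc; apply/allP => c' c'C; apply/implyP => Pc'.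
  by apply: cmin; rewrite mem_filter Pc'.
case/andP: (Pc) => cu cy; exists c => //; split=> //.
  move=> c' c'C; rewrite le_eqVlt => /orP[/eqP c'u|c'u].
    by rewrite !dotE -c'u (zuy c')// !mulr0 subr0.
  rewrite !dotE subr_ge0; have [c'y|c'y] := leP (dot c' y) 0.
    by rewrite (le_trans (mulr_ge0_le0 (ltW cu) c'y))// mulr_ge0// ltW.
  have := allP minc _ c'C; rewrite /P c'u c'y /= /ratio.
  rewrite ler_pdivrMr ?ltr0z// mulrAC ler_pdivlMr ?ltr0z//.
  by rewrite -!intrM ler_int [X in _ <= X]mulrC.
(* The product with the minimiser [c] becomes zero, and no product that vanished on [u] becomes
   non-zero. *)
rewrite /nonzeros -!size_filter; set s := [seq c' <- _ | _].
have su : uniq (c :: s).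
  rewrite /= filter_uniq ?box_uniq// andbT mem_filter !dotE.
  by rewrite (mulrC (dot c y)) subrr eqxx.
have /= := uniq_leq_size su; apply=> c'; rewrite inE => /orP[/eqP ->|].
  by rewrite mem_filter cC gt_eqF.
rewrite !mem_filter => /andP[+ c'C]; rewrite c'C andbT.
by apply: contraNN => /eqP c'u; rewrite !dotE c'u (zuy c')// !mulr0 subr0.
Qed.

Definition radius := ((2 * d * N) ^ d)%N.

(* Siegel's lemma: the vectors of [box] orthogonal to [u] span a space of
   dimension less than [d], so that by the pigeonhole principle two vectors
   with entries in [0, radius] have the same products with a basis of it. *)
Lemma siegel u : u != 0 -> exists y, [/\ y != 0, (vnorm y <= radius)%N &
  forall c, c \in C -> dot c u = 0 -> dot c y = 0].
Proof.
move=> u0; have d_gt0 : (0 < d)%N.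
  rewrite lt0n; apply: contraNneq u0 => d0; apply/eqP/rowP => j.
  by have := ltn_ord j; rewrite [X in (_ < X)%N]d0.
pose Z := [seq c <- C | dot c u == 0].
pose toQ (v : 'rV[int]_d) : 'rV[rat]_d := map_mx intr v.
have dotQ v v' : (toQ v *m (toQ v')^T) ord0 ord0 = (dot v v')%:~R.
  rewrite !mxE /dot rmorph_sum; apply: eq_bigr => j _.
  by rewrite !mxE rmorphM.
pose A : 'M[rat]_(size Z, d) := \matrix_i toQ (tnth (in_tuple Z) i).
have AE v i : (A *m (toQ v)^T) i ord0 = (dot (tnth (in_tuple Z) i) v)%:~R.
  by rewrite -dotQ !mxE; apply: eq_bigr => k _; rewrite !mxE.
have rankA : (\rank A < d)%N.
  rewrite ltn_neqAle rank_leq_col andbT; apply: contraNN u0 => /eqP rA.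
  have Afull : row_full A by rewrite /row_full rA.
  have : A *m (toQ u)^T = 0.
    apply/colP => i; rewrite AE mxE.
    have := mem_tnth i (in_tuple Z); rewrite mem_filter => /andP[/eqP -> _].
    by rewrite rmorph0.
  move=> /(congr1 (mulmx (pinvmx A))); rewrite mulmx0 mulmxA mulVpmx// mul1mx.
  move=> /matrixP uT0; apply/eqP/rowP => j; have := uT0 j ord0.
  by rewrite !mxE => /eqP; rewrite intr_eq0 => /eqP.
pose f := maxrankfun A; pose X := radius.
pose vec (g : {ffun 'I_d -> 'I_X.+1}) : 'rV[int]_d := \row_j (g j : nat)%:Z.
pose b (i : 'I_(\rank A)) := tnth (in_tuple Z) (f i).
have vecX g : (vnorm (vec g) <= X)%N.
  by apply/vnormP => j; rewrite mxE -ltnS ltn_ord.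
have bC i : b i \in C.
  by have := mem_tnth (f i) (in_tuple Z); rewrite mem_filter => /andP[].
pose Y := (d * N * X)%N.
pose img (g : {ffun 'I_d -> 'I_X.+1}) : {ffun 'I_(\rank A) -> 'I_Y.*2.+1} :=
  [ffun i => inord `|(dot (b i) (vec g) + Y%:Z)%R|%N].
have imgE g g' i : img g = img g' -> dot (b i) (vec g) = dot (b i) (vec g').
  have bd h : `|dot (b i) (vec h)| <= Y%:Z.
    by apply: dot_le; rewrite ?vecX// -mem_box bC.
  move=> /ffunP/(_ i)/(congr1 val); rewrite !ffunE.
  have := bd g; have := bd g'; move: (dot _ _) (dot _ _) => m n mY nY.
  rewrite /= !inordK -?muln2; lia.
have [g [g' gg' imgg]] : exists g, exists2 g', g != g' & img g = img g'.
  apply: contrapT => inj_img.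
  have : injective img.
    move=> g g' gg'; apply/eqP; apply/negPn/negP => ne.
    by apply: inj_img; exists g, g'.
  move=> /leq_card; rewrite !card_ffun !card_ord leqNgt => /negP; apply.
  (* Each product takes at most [2Y + 1] values and there are at most [d - 1] of them, so
     [(2dN)^(d-1) < X + 1] suffices; this dictates [radius]. *)
  have Yle : (Y.*2.+1 <= 2 * d * N * X.+1)%N by rewrite /Y -muln2; nia.
  apply: leq_ltn_trans (_ : (2 * d * N * X.+1) ^ d.-1 < _)%N.
    apply: leq_trans (leq_pexp2l _ (_ : (_ <= d.-1)%N)) _ => //.
      by rewrite -ltnS prednK.
    by case: (d.-1) => // k; rewrite leq_exp2r.
  rewrite expnMn -[in X in (_ < X)%N](prednK d_gt0) [in X in (_ < X)%N]expnS.
  rewrite ltn_pmul2r ?expn_gt0// ltnS /X /radius leq_pexp2l ?leq_pred//.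
  by rewrite !muln_gt0 d_gt0 N_gt0.
(* Every row of [A] is a combination of the rows selected by [f], so agreement on these extends to
   all of [Z]. *)
have span c : c \in C -> dot c u = 0 -> dot c (vec g) = dot c (vec g').
  move=> cC cu; have /tnthP[k ck] : c \in in_tuple Z.
    by rewrite mem_filter cu eqxx.
  have /submxP[D rowk] : (row k A <= rowsub f A)%MS.
    by rewrite (submx_trans (row_sub _ _))// eq_maxrowsub.
  have rowkE v : row k A *m (toQ v)^T = (dot c v)%:~R%:M.
    apply/rowP => j; rewrite ord1 -row_mul mxE AE -ck.
    by rewrite mxE eqxx mulr1n.
  have : row k A *m (toQ (vec g))^T = row k A *m (toQ (vec g'))^T.
    rewrite rowk -!mulmxA; congr (_ *m _); apply/colP => l.
    have subE v : (rowsub f A *m (toQ v)^T) l ord0 = (dot (b l) v)%:~R.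
      by rewrite -AE !mxE; apply: eq_bigr => j _; rewrite !mxE.
    by rewrite !subE (imgE _ _ _ imgg).
  by rewrite !rowkE => /matrixP/(_ ord0 ord0); rewrite !mxE => /intr_inj.
exists (vec g - vec g'); split.
- rewrite subr_eq0; apply: contraNN gg' => /eqP/rowP vgg'.
  by apply/eqP/ffunP => j; apply/val_inj; have := vgg' j; rewrite !mxE => -[].
- apply/vnormP => j; rewrite !mxE.
  have := ltn_ord (g j); have := ltn_ord (g' j).
  by move: (nat_of_ord (g j)) (nat_of_ord (g' j)) => m n; rewrite /X; lia.
- by move=> c cC cu; rewrite !dotE (span _ _ cu)// subrr.
Qed.

Definition dirs : seq 'rV[int]_d := [seq u <- box d radius | u != 0].

Lemma mem_dirs u : (u \in dirs) = (u != 0) && (vnorm u <= radius)%N.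
Proof. by rewrite mem_filter mem_box. Qed.

(** Induction on [nonzeros u]. If neither sign of Siegel's vector [y] lies in the closed face of
    [u], moving from [u] against [y] ends on a smaller face. *)
Lemma conformal_dir u : u != 0 -> exists2 r, r \in dirs & conformal r u.
Proof.
have [n] := ubnP (nonzeros u); elim: n u => // n IH u; rewrite ltnS => un u0.
have [y [y0 yX zuy]] := siegel u0.
have [cyu|cyu] := pselect (conformal y u).
  by exists y; rewrite ?mem_dirs ?y0.
have [cNyu|cNyu] := pselect (conformal (- y) u).
  by exists (- y); rewrite ?mem_dirs ?oppr_eq0 ?vnormN ?y0.
have pos z : (forall c, c \in C -> dot c u = 0 -> dot c z = 0) ->
    ~ conformal z u -> exists2 c, c \in C & (0 < dot c u) && (dot c z < 0).
  move=> zuz ncz; apply: contrapT => npos; apply: ncz => c cC cu.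
  rewrite leNgt; apply/negP => cz; apply: npos; exists c; rewrite // cz andbT.
  by rewrite lt_neqAle cu andbT eq_sym; apply: contraTneq cz => /(zuz _ cC) ->.
have [|c1 c1C /andP[c1u c1y]] := pos _ _ cNyu.
  by move=> c cC cu; rewrite dotNr zuy ?oppr0.
have [||c cC [cu cy cfu' lt_u']] := @conformal_reduce u y.
- exact: zuy.
- by exists c1; rewrite // c1u; move: c1y; rewrite dotNr oppr_lt0.
have [|r rdirs ru'] := IH _ (leq_trans lt_u' un).
  (* Were the reduced vector zero, [y] would be a positive multiple of [u], hence conformal to
     it. *)
  apply: contra_not_neq cyu => /eqP; rewrite subr_eq0 => /eqP uy c' c'C c'u.
  have := congr1 (dot c') uy; rewrite !dotZr => uy'.
  by rewrite -(pmulr_rge0 _ cu) -uy' mulr_ge0// ltW.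
by exists r => //; apply: conformal_trans cfu'.
Qed.

(* The support function of the zonotope spanned by [box d N]. *)
Definition supp u : int := \sum_(c <- C) `|dot c u|.

Lemma supp_gt0 u : u != 0 -> 0 < supp u.
Proof.
move=> /neq0_box[c cC cu]; rewrite /supp (big_rem c)//=.
by rewrite ltr_pwDl ?normr_gt0 ?gt_eqF// sumr_ge0.
Qed.

Lemma supp_ge0 u : 0 <= supp u. Proof. exact: sumr_ge0. Qed.

Lemma suppN u : supp (- u) = supp u.
Proof. by apply: eq_bigr => c _; rewrite dotNr normrN. Qed.

(** Splitting off a direction from the closed face of [u] lowers [nonzeros], and [supp] is additive
    along such conformal sums. As [supp r] is a positive integer, the error [S] may be replaced by
    [S * supp r], which is additive as well. *)
Lemma dot_le_supp a (lam S : int) : 0 <= S ->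
  (forall r, r \in dirs -> dot r a <= lam * supp r + S) ->
  forall u, dot u a <= (lam + S) * supp u.
Proof.
move=> S0 Sdirs u; have [n] := ubnP (nonzeros u).
elim: n u => // n IH u; rewrite ltnS => un.
have [->|u0] := eqVneq u 0.
  by rewrite dot0l /supp big1 ?mulr0// => c _; rewrite dot0r.
have [r rdirs ru] := conformal_dir u0.
have r0 : r != 0 by move: rdirs; rewrite mem_dirs => /andP[].
have Sr : dot r a <= (lam + S) * supp r.
  rewrite (le_trans (Sdirs r rdirs))// mulrDl lerD2l ler_peMr//.
  exact: supp_gt0.
have [||c cC [cu cr cfu' lt_u']] := @conformal_reduce u r.
- by move=> c cC; apply: conformal_eq0.
- have [c cC cr] := neq0_box r0; exists c; rewrite // cr andbT ltNge.
  apply: contraTN cr => cu; rewrite -leNgt -oppr_ge0 -dotNl.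
  by apply: ru; rewrite ?boxN// dotNl oppr_ge0.
set k := dot c r in cr cfu' lt_u'; set l := dot c u in cu cfu' lt_u'.
set u' := _ - _ in cfu' lt_u'.
have suppE : k * supp u = supp u' + l * supp r.
  rewrite !mulr_sumr -big_split; apply: eq_big_seq => e eC /=.
  have [eu|eu] := lerP 0 (dot e u).
    rewrite !ger0_norm ?(ru e)// ?(cfu' e)//; rewrite !dotE; ring.
  have {}eu : 0 <= dot (- e) u by rewrite dotNl oppr_ge0 ltW.
  rewrite -(normrN (dot e u)) -(normrN (dot e u')) -(normrN (dot e r)) -!dotNl.
  rewrite !ger0_norm ?ru ?cfu' ?boxN//; rewrite !dotE; ring.
have uE : k * dot u a = dot u' a + l * dot r a by rewrite /u' !dotE; ring.
rewrite -(ler_pM2l cr) uE mulrCA suppE mulrDr lerD//.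
  by rewrite IH// (leq_trans lt_u').
by rewrite mulrCA ler_pM2l.
Qed.

(* Two directions in which [a] leaves the zonotope scaled by [lam] lie in a
   common cone of its normal fan: otherwise [supp] is strictly subadditive on
   them. *)
Lemma active_compatible a (lam S H : int) :
  0 <= S -> (forall u, u \in dirs -> supp u <= H) -> S * H <= lam ->
  (forall r, r \in dirs -> dot r a <= lam * supp r + S) ->
  forall u u' c, u \in dirs -> u' \in dirs -> c \in C ->
    lam * supp u < dot u a -> lam * supp u' < dot u' a ->
    0 < dot c u -> 0 <= dot c u'.
Proof.
move=> S0 suppH SH Sdirs u u' c ud u'd cC ua u'a cu.
rewrite leNgt; apply/negP => cu'.
(* The products with [c] are non-zero integers of opposite sign, so the triangle inequality loses at
   least 2. *)
have suppD : supp (u + u') + 2 <= supp u + supp u'.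
  have : \sum_(e <- rem c C) `|dot e (u + u')| <=
      \sum_(e <- rem c C) `|dot e u| + \sum_(e <- rem c C) `|dot e u'|.
    by rewrite -big_split; apply: ler_sum => e _; rewrite dotDr ler_normD.
  rewrite /supp !(big_rem c cC)/= dotDr.
  move: (dot c u) (dot c u') cu cu' (\sum_(e <- _) _) (\sum_(e <- _) _).
  move=> m n m0 n0 x y; move: (\sum_(e <- _) _) => z; lia.
(* With x and x' the supports of [u] and [u'], lam (x + x') < (lam + S) (x + x' - 2), hence 2 lam +
   2 S < S (x + x') <= 2 S H <= 2 lam. *)
have := dot_le_supp S0 Sdirs (u + u'); rewrite dotDl.
have := suppH u ud; have := suppH u' u'd; have := supp_ge0 u.
move: (supp u) (supp u') (supp (u + u')) (dot u a) (dot u' a) suppD ua u'a.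
move=> x x' z m m' zxx' xm x'm' x0 x'H xH le_z.
have lam0 : 0 <= lam by apply: le_trans SH; rewrite mulr_ge0// (le_trans x0).
have := ler_wpM2l (addr_ge0 lam0 S0) (_ : z <= x + x' - 2).
have := ler_wpM2l S0 xH; have := ler_wpM2l S0 x'H.
move: le_z xm x'm' SH; rewrite !(mulrDl, mulrDr, mulrN); lia.
Qed.

End Conformal.

Section Bounds.
Local Open Scope ring_scope.
Context (d : nat).

Lemma supp_le n K (u : 'rV[int]_d) : (vnorm u <= K)%N ->
  supp n u <= (n.*2.+1 ^ d * (d * n * K))%N%:Z.
Proof.
move=> uK; apply: (@le_trans _ _ (size (box d n) * (d * n * K))%N%:Z).
  rewrite /supp; have : {subset box d n <= box d n} by [].
  elim: {1 3 4}(box d n) => [|c s IH] sub; first by rewrite big_nil.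
  rewrite big_cons mulSn PoszD lerD//.
    by apply: dot_le => //; rewrite -mem_box sub// mem_head.
  by apply: IH => c' c's; rewrite sub// in_cons c's orbT.
by rewrite lez_nat leq_mul2r size_box orbT.
Qed.

Lemma size_dirs n : (size (dirs d n) <= (radius d n).*2.+1 ^ d)%N.
Proof. by rewrite size_filter (leq_trans (count_size _ _))// size_box. Qed.

End Bounds.

(** * Safe sets *)

Section SafeSets.
Local Open Scope ring_scope.
Context (d : nat) (G : game_graph d).
Implicit Types (v : G) (a x u w : 'rV[int]_d).

Definition safe (P : config G -> Prop) : Prop :=
  forall v a, P (v, a) ->
    (v \in vertices1 G ->
      exists w v', (v, w, v') \in edges G /\ P (v', a + w)) /\
    (v \notin vertices1 G ->
      forall w v', (v, w, v') \in edges G -> P (v', a + w)).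

Definition bounded (B : nat) (P : config G -> Prop) : Prop :=
  forall c, P c -> (vnorm c.2 <= B)%N.

Lemma vnorm_edge v w v' : (v, w, v') \in edges G -> (vnorm w <= enorm G)%N.
Proof. by move=> e; rewrite /enorm (big_rem _ e) /= leq_maxl. Qed.

End SafeSets.

Lemma exists_max (T : Type) (P : T -> Prop) (f : T -> int) (b : int) (x : T) :
  P x -> (forall y, P y -> (f y <= b)%R) ->
  exists2 y, P y & forall z, P z -> (f z <= f y)%R.
Proof.
move=> Px fb; apply: contrapT => nmax.
have up n : exists2 y, P y & (f x + n%:Z <= f y)%R.
  elim: n => [|n [y Py xy]]; first by exists x; rewrite ?addr0.
  apply: contrapT => ny; apply: nmax; exists y => // z Pz.
  rewrite leNgt; apply/negP => yz; apply: ny; exists z => //; lia.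
have [y Py] := up `|b - f x|.+1%N; have := fb _ Py; lia.
Qed.

(** For removals from a stack: a surviving element never moves up, and keeps its position only if
    everything below it survives. *)
Lemma filter_index (T : eqType) (p : pred T) (s : seq T) x0 i :
  uniq s -> (i < size (filter p s))%N ->
  let k := index (nth x0 (filter p s) i) s in
  (i <= k)%N /\ (k = i -> take i.+1 (filter p s) = take i.+1 s).
Proof.
elim: s i => //= x s IH i /andP[xs us]; have [px|npx] /= := boolP (p x).
  case: i => [|i] /=; first by rewrite eqxx !take0.
  rewrite ltnS => si; have [le_i eq_i] := IH i us si.
  case: eqP => [xE|_]; last by split=> // -[] /eq_i ->.
  by have := mem_nth x0 si; rewrite -xE mem_filter (negbTE xs) andbF.
move=> si; have [le_i _] := IH i us si.
case: eqP => [xE|_]; last by split; [exact: leqW | move: le_i; lia].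
by have := mem_nth x0 si; rewrite -xE mem_filter (negbTE xs) andbF.
Qed.

(** * The safe set modelled on a zonotope *)

Section Reduction.
Local Open Scope ring_scope.
Context (d : nat) (G : game_graph d) (W : config G -> Prop) (B : nat).
Hypotheses (safeW : safe W) (boundedW : bounded B W).
Hypothesis enorm_gt0 : (0 < enorm G)%N.
Implicit Types (v : G) (a x u w c : 'rV[int]_d) (p : seq ('rV[int]_d * G)).

Definition inhabited_at v := exists a, W (v, a).

(** The inequality [h v + dot x w <= h v'] between the maxima [h] of [dot x] over the slices of [W],
    phrased so that no maximum has to exist. *)
Definition allowed x v w v' :=
  (v, w, v') \in edges G /\
  forall a, W (v, a) -> exists2 a', W (v', a') & dot x (a + w) <= dot x a'.

Fixpoint walk x v p : Prop :=
  if p is (w, v') :: p' then allowed x v w v' /\ walk x v' p' else True.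

Definition endpoint v p : G := last v (map snd p).
Definition total p : 'rV[int]_d := \sum_(e <- p) e.1.

Lemma total_cat p1 p2 : total (p1 ++ p2) = total p1 + total p2.
Proof. exact: big_cat. Qed.

Lemma walk_cat x v p1 p2 :
  walk x v (p1 ++ p2) <-> walk x v p1 /\ walk x (endpoint v p1) p2.
Proof.
elim: p1 v => [|[w v'] p1 IH] v /=; first by split=> [|[]].
by rewrite IH; split=> [[? []]|[[]]].
Qed.

Lemma allowed_max x v : inhabited_at v ->
  exists2 a, W (v, a) & forall a', W (v, a') -> dot x a' <= dot x a.
Proof.
move=> [a Wa].
apply: (exists_max (b := (d * vnorm x * B)%N%:Z) (x := a)) => // a' Wa'.
by rewrite (le_trans (ler_norm _))// dot_le//; apply: (boundedW Wa').
Qed.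

Lemma allowed_player2 x v w v' : v \notin vertices1 G ->
  (v, w, v') \in edges G -> allowed x v w v'.
Proof.
move=> v2 e; split=> // a Wa; exists (a + w) => //.
by have [_] := safeW Wa; apply.
Qed.

(** A safe move from a configuration maximising [dot x] over the slice at [v] serves the whole
    slice. *)
Lemma allowed_player1 x v : v \in vertices1 G -> inhabited_at v ->
  exists w v', allowed x v w v'.
Proof.
move=> v1 Wv; have [a Wa amax] := allowed_max x Wv.
have [/(_ v1)[w [v' [e Wv']]] _] := safeW Wa.
exists w, v'; split=> // a' Wa'; exists (a + w) => //.
by rewrite !dotDr lerD2r amax.
Qed.

Lemma walk_dot x v p a : walk x v p -> W (v, a) ->
  exists2 a', W (endpoint v p, a') & dot x (a + total p) <= dot x a'.
Proof.
elim: p v a => [|[w v'] p IH] v a /=.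
  by move=> _ Wa; exists a; rewrite /total ?big_nil ?addr0.
move=> [[e vv'] v'p] Wa; have [a1 Wa1 aa1] := vv' _ Wa.
have [a2 Wa2 a12] := IH _ _ v'p Wa1; exists a2 => //.
by rewrite (le_trans _ a12)// /total big_cons addrA !dotDr lerD2r -dotDr.
Qed.

Lemma walk_inhabited x v p : walk x v p -> inhabited_at v ->
  inhabited_at (endpoint v p).
Proof. by move=> vp [a /(walk_dot vp)[a' Wa' _]]; exists a'. Qed.

Lemma cycle_dot x v p : walk x v p -> endpoint v p = v -> inhabited_at v ->
  dot x (total p) <= 0.
Proof.
move=> vp pv Wv; have [a Wa amax] := allowed_max x Wv.
have [a' Wa'] := walk_dot vp Wa; rewrite pv in Wa'.
by rewrite dotDr => /le_trans/(_ (amax _ Wa')); rewrite gerDl.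
Qed.

Lemma vnorm_total x v p : walk x v p -> (vnorm (total p) <= size p * enorm G)%N.
Proof.
elim: p v => [|[w v'] p IH] v /=; first by rewrite /total big_nil vnorm0.
move=> [[e _] /IH le_p]; rewrite /total big_cons mulSn.
by rewrite (leq_trans (vnormD _ _))// leq_add// (vnorm_edge e).
Qed.

Definition cycle_bound := (#|G| * enorm G)%N.

Lemma cycle_bound_gt0 : G -> (0 < cycle_bound)%N.
Proof.
by move=> v; rewrite muln_gt0 enorm_gt0 andbT; apply/card_gt0P; exists v.
Qed.

(* A walk is split into cycles of length at most [#|G|] and a remaining walk
   shorter than [#|G|]; the cycles contribute nothing positive to [u]. *)
Lemma walk_bound x u (M : int) v p :
  (forall c, (vnorm c <= cycle_bound)%N -> dot x c <= 0 -> dot u c <= 0) ->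
  (forall c, (vnorm c <= cycle_bound)%N -> dot u c <= M) ->
  walk x v p -> inhabited_at v -> dot u (total p) <= M.
Proof.
move=> xu uM; have [n] := ubnP (size p); elim: n p => // n IH p.
rewrite ltnS => pn vp Wv; have [ltp|gep] := ltnP (size p) #|G|.
  by apply: uM; rewrite (leq_trans (vnorm_total vp))// leq_mul2r ltnW ?orbT.
pose t := v :: map snd (take #|G| p).
have size_t : size t = #|G|.+1 by rewrite /= size_map size_takel.
have /(uniqPn v)[i [j [ij]]] : ~~ uniq t.
  apply/negP => /card_uniqP tG; have := max_card (mem t).
  by rewrite tG size_t ltnn.
rewrite size_t ltnS => jG tij.
have tE k : (k <= #|G|)%N -> nth v t k = endpoint v (take k p).
  move=> kG; rewrite /endpoint map_take (last_nth v) size_take size_map.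
  have -> : (if (k < size p)%N then k else size p) = k.
    by case: ltnP => // pk; apply/eqP; rewrite eqn_leq pk (leq_trans kG).
  by rewrite /t map_take; case: k kG => //= k kG; rewrite !nth_take.
have [iG ip] : (i <= #|G|)%N /\ (j <= size p)%N.
  by rewrite (leq_trans (ltnW ij) jG) (leq_trans jG).
pose p1 := take i p; pose p2 := take (j - i) (drop i p); pose p3 := drop j p.
have pE : p = p1 ++ p2 ++ p3.
  have -> : p3 = drop (j - i) (drop i p) by rewrite drop_drop subnK// ltnW.
  by rewrite !cat_take_drop.
have p12 : take j p = p1 ++ p2.
  by rewrite /p1 /p2 -takeD subnKC// ltnW.
move: vp; rewrite pE => /walk_cat[vp1 /walk_cat[vp2 vp3]].
have Wi := walk_inhabited vp1 Wv.
have p2c : endpoint (endpoint v p1) p2 = endpoint v p1.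
  have {2}-> : endpoint v p1 = endpoint v (p1 ++ p2) by rewrite -p12 -!tE.
  by rewrite /endpoint map_cat last_cat.
have szp2 : size p2 = (j - i)%N.
  by rewrite size_takel// size_drop leq_sub2r.
rewrite !total_cat addrCA dotDr -[M]add0r lerD//.
  apply: xu; last exact: cycle_dot vp2 p2c Wi.
  rewrite (leq_trans (vnorm_total vp2))// leq_mul2r szp2.
  by rewrite (leq_trans (leq_subr _ _) jG) orbT.
rewrite -total_cat; apply: IH => //; last first.
  by apply/walk_cat; split=> //; rewrite -p2c.
apply: leq_trans pn; rewrite pE !size_cat ltn_add2l szp2.
by rewrite -[X in (X < _)%N]add0n ltn_add2r subn_gt0.
Qed.


Local Notation dirs := (dirs d cycle_bound).
Local Notation X := (radius d cycle_bound).

Definition base : int := (d * X * (2 * B + enorm G))%N%:Z + 1.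

(* Since [base] exceeds all products with elements of [dirs] that matter, [comb]
   compares weights lexicographically: the directions at the head of the
   sequence are infinitely heavier than the later ones. *)
Definition comb (s : seq 'rV[int]_d) : 'rV[int]_d :=
  foldl (fun x u => base *: x + u) 0 s.

Lemma comb_rcons s u : comb (rcons s u) = base *: comb s + u.
Proof. by rewrite /comb -cats1 foldl_cat. Qed.

(** A violation for [x] costs at least one by integrality, hence at least [base] in the combination,
    more than [u] can recover. *)
Lemma allowed_scale x u v w v' : (vnorm u <= X)%N ->
  allowed (base *: x + u) v w v' -> allowed x v w v'.
Proof.
move=> uX [e vv']; split=> // a Wa; have [a' Wa' le_a'] := vv' _ Wa.
exists a' => //; rewrite leNgt; apply/negP => lt_a'.
have := dot_le uX (_ : vnorm (a' - (a + w)) <= 2 * B + enorm G)%N.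
rewrite (leq_trans (vnormD _ _))//; last first.
  rewrite mul2n -addnn -addnA leq_add ?(boundedW Wa')// vnormN.
  by rewrite (leq_trans (vnormD _ _))// leq_add ?(boundedW Wa)// (vnorm_edge e).
rewrite !dotDl !dotZl in le_a'; rewrite dotDr dotNr => /(_ isT) le_u.
have : base <= base * (dot x (a + w) - dot x a').
  by rewrite ler_peMr /base; lia.
by rewrite mulrBr; move: le_a' le_u; rewrite /base; lia.
Qed.

Lemma allowed_comb s t v w v' : {subset t <= dirs} ->
  allowed (comb (s ++ t)) v w v' -> allowed (comb s) v w v'.
Proof.
elim/last_ind: t => [|t u IH]; first by rewrite cats0.
move=> tdirs; rewrite -rcons_cat comb_rcons => /allowed_scale uX.
apply: IH => [z zt|]; first by rewrite tdirs// mem_rcons in_cons zt orbT.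
apply: uX; have := tdirs u; rewrite mem_rcons mem_head mem_dirs.
by move=> /(_ isT)/andP[].
Qed.

(** One positive product with an element of [s] makes all of them nonnegative, and then [comb s] has
    a positive product too. *)
Lemma comb_compatible s c :
  (forall u u', u \in s -> u' \in s -> 0 < dot c u -> 0 <= dot c u') ->
  dot c (comb s) <= 0 -> forall u, u \in s -> dot c u <= 0.
Proof.
move=> scompat.
suff pos : forall u, u \in s -> 0 < dot c u -> 0 < dot c (comb s).
  move=> cs u us; rewrite leNgt; apply: contraTN cs => /(pos u us).
  by rewrite ltNge.
move=> u us cu; have {}scompat u' : u' \in s -> 0 <= dot c u'.
  by move=> u's; apply: scompat us u's cu.
have base_gt0 : 0 < base by rewrite /base; lia.
have nonneg t : {subset t <= s} -> 0 <= dot c (comb t).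
  elim/last_ind: t => [|t z IH] ts; first by rewrite dot0r.
  rewrite comb_rcons dotDr dotZr addr_ge0//.
    apply: mulr_ge0; first exact: ltW.
    by apply: IH => y yt; rewrite ts// mem_rcons in_cons yt orbT.
  by rewrite scompat// ts// mem_rcons mem_head.
suff ge t : {subset t <= s} -> forall z, z \in t -> dot c z <= dot c (comb t).
  by rewrite (lt_le_trans cu)// ge.
elim/last_ind: t => // t z IH ts y.
have tsub : {subset t <= s}.
  by move=> y' yt; rewrite ts// mem_rcons in_cons yt orbT.
rewrite mem_rcons in_cons comb_rcons dotDr dotZr => /predU1P[->|yt].
  by rewrite lerDr mulr_ge0 ?nonneg// ltW.
rewrite (le_trans (IH tsub _ yt))// -[X in X <= _]addr0 lerD//; last first.
  by rewrite scompat// ts// mem_rcons mem_head.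
by rewrite ler_peMl ?nonneg// /base; lia.
Qed.

(** Bounds on what a direction gains on a simple cycle and on a single edge; [slack] allows for one
    step and for one gain per possible stack position. *)
Definition maxgain : nat := (d * X * cycle_bound)%N.
Definition maxstep : nat := (d * X * enorm G)%N.
Definition slack : nat := (maxstep + size dirs * maxgain)%N.

Context (H : int).
Hypothesis suppH : forall u, u \in dirs -> supp cycle_bound u <= H.

(** The smallest factor that [active_compatible] admits for the error [slack]. *)
Definition scale : int := slack%:Z * H.
Definition active a u := scale * supp cycle_bound u < dot u a.
Definition level (i : nat) u : int :=
  scale * supp cycle_bound u + (maxstep + (size dirs - i) * maxgain)%N%:Z.

(* The sequence [s] lists the active directions by decreasing age. A direction
   that moves from position [i] to a smaller one has its potential recomputed,
   at a cost of at most [maxgain]; this is why [level] decreases with [i]. *)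
Definition stack_invariant v a s : Prop :=
  [/\ inhabited_at v, uniq s,
      forall u, (u \in s) = (u \in dirs) && active a u &
      forall i p, (i < size s)%N -> walk (comb (take i.+1 s)) v p ->
        dot (nth 0 s i) (a + total p) <= level i (nth 0 s i)].

Lemma stack_bound v a s : stack_invariant v a s ->
  forall u, u \in dirs -> dot u a <= scale * supp cycle_bound u + slack%:Z.
Proof.
move=> [_ _ smem sP] u udirs; have [us|] := boolP (u \in s).
  have := sP (index u s) [::]; rewrite index_mem nth_index//= /total big_nil.
  rewrite addr0 => /(_ us I)/le_trans; apply.
  by rewrite lerD2l lez_nat leq_add2l leq_mul2r leq_subr orbT.
by rewrite smem udirs /active -leNgt => /le_trans; apply; rewrite lerDl.
Qed.

Lemma dirs_gain u c :
  u \in dirs -> (vnorm c <= cycle_bound)%N -> dot u c <= maxgain%:Z.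
Proof.
rewrite mem_dirs => /andP[_ uX] cN.
by rewrite (le_trans (ler_norm _))// dot_le.
Qed.

Lemma dirs_step v w v' u : u \in dirs -> (v, w, v') \in edges G ->
  dot u w <= maxstep%:Z.
Proof.
rewrite mem_dirs => /andP[_ uX] /vnorm_edge wE.
by rewrite (le_trans (ler_norm _))// dot_le.
Qed.

(** The new stack keeps the survivors [f] in order and puts the newly active directions [g] on
    top. *)
Lemma stack_step v a s w v' : stack_invariant v a s ->
  allowed (comb s) v w v' -> exists s', stack_invariant v' (a + w) s'.
Proof.
move=> inv vv'; have [Wv us smem sP] := inv; have [e _] := vv'.
have Wv' : inhabited_at v' by case: Wv => b /(proj2 vv')[b' Wb' _]; exists b'.
have sdirs : {subset s <= dirs} by move=> u; rewrite smem => /andP[].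
have vv'i i : allowed (comb (take i s)) v w v'.
  apply: (@allowed_comb _ (drop i s)); last by rewrite cat_take_drop.
  by move=> u /mem_drop/sdirs.
(* The move just made, followed by [p], is a walk that the old invariant already accounts for. *)
have step_s i p : (i < size s)%N -> walk (comb (take i.+1 s)) v' p ->
    dot (nth 0 s i) (a + w + total p) <= level i (nth 0 s i).
  move=> si v'p; have := sP i ((w, v') :: p) si; rewrite /total big_cons addrA.
  by apply; split; first exact: vv'i.
pose act := active (a + w).
pose f := filter act s; pose g := [seq u <- dirs | act u && (u \notin s)].
have old u : u \in dirs -> u \notin s -> dot u a <= scale * supp cycle_bound u.
  by move=> ud; rewrite smem ud /active -leNgt.
have Sdirs u : u \in dirs ->
    dot u (a + w) <= scale * supp cycle_bound u + slack%:Z.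
  move=> ud; have [us'|nus] := boolP (u \in s).
    have := step_s (index u s) [::]; rewrite index_mem nth_index//=.
    rewrite /total big_nil addr0 => /(_ us' I)/le_trans; apply.
    by rewrite lerD2l lez_nat leq_add2l leq_mul2r leq_subr orbT.
  by rewrite dotDr lerD ?old// (le_trans (dirs_step ud e))// lez_nat leq_addr.
have mem_fg u : (u \in f ++ g) = (u \in dirs) && act u.
  have gE : (u \in g) = (act u && (u \notin s)) && (u \in dirs).
    exact: mem_filter.
  rewrite mem_cat gE [u \in f]mem_filter; have [us'|_] := boolP (u \in s).
    by rewrite (sdirs _ us') andbT andbF orbF.
  by rewrite andbF andbT andbC.
(* Active directions have compatible signs on cycle weights, so a cycle harmless for the combination
   is harmless for each of them, and [walk_bound] applies. *)
have compat i p : walk (comb (take i (f ++ g))) v' p ->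
    forall u, u \in take i (f ++ g) -> dot u (total p) <= maxgain%:Z.
  move=> v'p u ui.
  have fgi z : z \in take i (f ++ g) -> (z \in dirs) /\ act z.
    by move=> /mem_take; rewrite mem_fg => /andP[].
  have [ud _] := fgi u ui.
  apply: walk_bound v'p Wv' => c cN; last exact: dirs_gain.
  rewrite !(dotC _ c) => cc; apply: comb_compatible ui => // z z' /fgi[zd za].
  move=> /fgi[z'd z'a]; rewrite /act /active in za z'a.
  apply: (active_compatible (cycle_bound_gt0 v) _ suppH _ Sdirs zd z'd _ za
    z'a) => //.
  by rewrite mem_box.
have gE u : (u \in g) = (act u && (u \notin s)) && (u \in dirs).
  exact: mem_filter.
have ufg : uniq (f ++ g).
  rewrite cat_uniq !filter_uniq ?box_uniq// andbT; apply/hasPn => u.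
  rewrite gE => /andP[/andP[_ us'] _].
  by apply: contraNN us'; rewrite mem_filter => /andP[].
have szfg : (size (f ++ g) <= size dirs)%N.
  by apply: uniq_leq_size => // u; rewrite mem_fg => /andP[].
exists (f ++ g); split=> // i p ifg v'p.
have gain := compat _ _ v'p; rewrite dotDr.
have {}gain : dot (nth 0 (f ++ g) i) (total p) <= maxgain%:Z.
  apply: gain; rewrite -(nth_take 0 (ltnSn i)) mem_nth//.
  by rewrite size_takel.
have [fi|nfi] := ltnP i (size f).
  rewrite nth_cat fi in gain *; set u := nth 0 f i in gain *.
  have uf : u \in f by rewrite mem_nth.
  have us' : u \in s by move: uf; rewrite mem_filter => /andP[].
  have [/=] := filter_index 0 us fi; rewrite -/f -/u; set k := index u s.
  have ks : (k < size s)%N by rewrite index_mem.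
  have kE : nth 0 s k = u by rewrite nth_index.
  (* Either nothing below [u] was removed and the old bound persists, or [u] moves down from [k] to
     [i] and the higher level pays for a new [maxgain]. *)
  rewrite leq_eqVlt => /predU1P[ik takeE|ik _].
    have uE : nth 0 s i = u by rewrite ik.
    have := step_s i p; rewrite uE dotDr; apply; first by rewrite ik.
    by rewrite -takeE// -(takel_cat g).
  have := step_s k [::] ks I; rewrite kE /total big_nil addr0 => le_k.
  rewrite (le_trans (lerD le_k gain))// /level -addrA lerD2l -PoszD lez_nat.
  rewrite -addnA leq_add2l -mulSnr leq_mul2r; apply/orP; right.
  by rewrite ltn_sub2l// (ltn_trans ik)// (leq_trans ks)// uniq_leq_size.
(* A new direction was inactive before this move: it exceeds the threshold by at most [maxstep],
   plus [maxgain] for the walk to come. *)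
have ug : nth 0 (f ++ g) i \in g.
  by rewrite nth_cat ltnNge nfi /= mem_nth// ltn_subLR// -size_cat.
move: ug; rewrite gE => /andP[/andP[_ us'] ud].
rewrite dotDr /level PoszD addrA lerD ?lerD ?old ?(dirs_step ud e)//.
rewrite (le_trans gain)// lez_nat leq_pmull// subn_gt0.
exact: leq_trans ifg szfg.
Qed.

Definition stack_safe (c : config G) : Prop :=
  exists s, stack_invariant c.1 c.2 s.

Lemma stack_safe_safe : safe stack_safe.
Proof.
move=> v a [s inv]; have [Wv _ _ _] := inv; split=> [v1|v2 w v' e].
  have [w [v' vv']] := allowed_player1 (comb s) v1 Wv.
  by exists w, v'; split; [case: vv' | exact: stack_step vv'].
exact: stack_step inv (allowed_player2 (comb s) v2 e).
Qed.

Lemma scale_ge0 : 0 <= H -> 0 <= scale. Proof. exact: mulr_ge0. Qed.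

Lemma stack_safe_init v a : W (v, a) -> 0 <= H -> stack_safe (v, 0).
Proof.
move=> Wa H0; exists [::]; split=> //; first by exists a.
move=> u; rewrite /active dot0r ltNge mulr_ge0 ?andbF//; last exact: supp_ge0.
exact: scale_ge0.
Qed.

(** Coordinates are products with unit vectors, which belong to [dirs] together with their
    negatives. *)
Lemma stack_safe_bounded (R : nat) : (0 < cycle_bound)%N ->
  (forall j, scale * supp cycle_bound (delta_mx ord0 j : 'rV[int]_d) + slack%:Z
    <= R%:Z) ->
  bounded R stack_safe.
Proof.
move=> Npos le_R [v a] [s inv]; apply/vnormP => j /=.
have ed : (delta_mx ord0 j : 'rV[int]_d) \in dirs.
  rewrite mem_dirs; apply/andP; split.
    by apply/eqP => /matrixP/(_ ord0 j); rewrite !mxE !eqxx.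
  apply/vnormP => i; rewrite mxE eqxx /=.
  have X0 : (0 < X)%N.
    have d0 : (0 < d)%N by apply: leq_ltn_trans (ltn_ord j).
    by rewrite expn_gt0 (muln_gt0 _ cycle_bound) Npos muln_gt0 d0.
  by case: eqP => // _; rewrite ltnW.
have eNd : - (delta_mx ord0 j : 'rV[int]_d) \in dirs.
  by move: ed; rewrite !mem_dirs oppr_eq0 vnormN.
have := stack_bound inv ed; have := stack_bound inv eNd.
rewrite suppN dotNl dot_delta; have := le_R j; move: (a _ _) (supp _ _) => x y.
lia.
Qed.

End Reduction.

(** * Safe sets and strategies *)

Section SafetyGames.
Local Open Scope ring_scope.
Context (d : nat) (G : game_graph d) (v0 : G).
Implicit Types (v : G) (a w : 'rV[int]_d) (c : config G) (h : seq (config G)).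

Lemma play_step (rho : nat -> config G) n :
  is_path (play_prefix rho n.+1) -> step (rho n) (rho n.+1) \in edges G.
Proof.
move=> /andP[_ /(sortedP (rho 0%N))/(_ n)].
by rewrite size_mkseq !nth_mkseq ?ltnS// => /(_ (leqnn _)).
Qed.

(** The strategy reads only the last configuration; outside [P] it takes an arbitrary edge. *)
Lemma safe_strategy (P : config G -> Prop) : safe P -> P (v0, 0) ->
  exists sigma, strategy Player1 sigma /\
    forall rho, play_from v0 rho -> consistent Player1 sigma rho ->
      forall n, P (rho n).
Proof.
move=> safeP P0.
pose good c (e : edge G) :=
  [/\ e \in edges G, e.1.1 = c.1 & P c -> P (e.2, c.2 + e.1.2)].
have ex_good c : exists e, c.1 \in vertices1 G -> good c e.
  case: c => v a /=; have [Pc|nPc] := pselect (P (v, a)).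
    have [v1|v2] := boolP (v \in vertices1 G).
      have [/(_ v1)[w [v' [e P']]] _] := safeP _ _ Pc.
      by exists (v, w, v'); split.
    by have [w [v' _]] := edges_total v; exists (v, w, v').
  by have [w [v' e]] := edges_total v; exists (v, w, v'); split.
have [pick pickP] := choice ex_good.
exists (fun s => pick (last (v0, 0) s)); split.
  by move=> s c _ c1; rewrite last_rcons; have [] := pickP c c1.
move=> rho [rho0 rhoP] rho_sigma; elim=> [|n IH]; first by rewrite rho0.
have e := play_step (rhoP n.+1).
have rhoS : rho n.+1 = ((rho n.+1).1, (rho n).2 + ((rho n.+1).2 - (rho n).2)).
  by rewrite addrC subrK -surjective_pairing.
have [v1|v2] := boolP ((rho n).1 \in vertices1 G).
  have := rho_sigma n v1; rewrite /play_prefix mkseqS last_rcons => step_n.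
  have [_ _ /(_ IH)] := pickP _ v1.
  by rewrite -step_n /= -rhoS.
rewrite rhoS; move: v2 e IH; rewrite /step.
by case: (rho n) => v a v2 e /safeP[_ /(_ v2)]; apply.
Qed.

Definition bounded_win v :=
  exists B P, [/\ safe P, bounded B P & P (v, 0)].

Lemma safe_translate (P : config G -> Prop) b :
  safe P -> safe (fun c => P (c.1, c.2 + b)).
Proof.
move=> safeP v a /safeP[p1 p2]; split=> [/p1[w [v' [e P']]]|/p2 P' w v' e] /=.
  by exists w, v'; rewrite addrAC.
by rewrite addrAC; apply: P'.
Qed.

Lemma bounded_win_uniform : exists B, forall v, bounded_win v ->
  exists P, [/\ safe P, bounded B P & P (v, 0)].
Proof.
have ex_B v : exists B, bounded_win v ->
    exists P, [/\ safe P, bounded B P & P (v, 0)].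
  by have [[B winB]|nwin] := pselect (bounded_win v); [exists B | exists 0%N].
have [B BP] := choice ex_B; exists (\max_v B v) => v /BP[P [safeP boundP Pv]].
exists P; split=> // c Pc; apply: leq_trans (boundP c Pc) _.
exact: leq_bigmax.
Qed.

Section Histories.
Context (sigma : seq (config G) -> edge G).

Inductive history : seq (config G) -> Prop :=
| History0 : history [:: (v0, 0)]
| HistoryS h c c' : history (rcons h c) -> step c c' \in edges G ->
    (c.1 \in vertices1 G -> step c c' = sigma (rcons h c)) ->
    history (rcons (rcons h c) c').

Lemma history_path h : history h -> is_path h.
Proof.
elim=> // {}h c c' _ /andP[_ hc] cc' _.
rewrite /is_path -size_eq0 size_rcons /=.
by case: h hc => [|b h]; rewrite /= ?andbT// !rcons_path !last_rcons => ->.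
Qed.

Hypothesis sigma_strategy : strategy Player1 sigma.

Lemma history_extend h v a w v' : history (rcons h (v, a)) ->
  (v \in vertices1 G -> (v, w, v') = sigma (rcons h (v, a))) ->
  (v, w, v') \in edges G ->
  history (rcons (rcons h (v, a)) (v', a + w)).
Proof.
have stepE : step (v, a) (v', a + w) = (v, w, v').
  by rewrite /step /= addrAC subrr add0r.
by move=> hist v1 e; apply: HistoryS; rewrite // stepE.
Qed.

(* If the histories extending [h] stayed within distance [R] of the origin as
   long as they avoid the vertices with [bounded_win], following [sigma] until
   such a vertex is reached would be a bounded way of playing. *)
Lemma history_escape h v a R : history (rcons h (v, a)) -> ~ bounded_win v ->
  exists h' c, [/\ history (rcons h' c), prefix (rcons h (v, a)) (rcons h' c),
    ~ bounded_win c.1 & (R < vnorm c.2)%N].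
Proof.
move=> hist nwin; apply: contrapT => nesc; apply: (nwin).
have [B BP] := bounded_win_uniform.
(* In [before], [sigma] is still followed, at a vertex without [bounded_win]; in [after], a winning
   vertex was reached at weight [b], and a safe set translated by [b] takes over. *)
pose before c := exists h', [/\ history (rcons h' c),
  prefix (rcons h (v, a)) (rcons h' c) & ~ bounded_win c.1].
pose after c := exists b Q, [/\ (vnorm b <= R + enorm G)%N, safe Q,
  bounded B Q & Q (c.1, c.2 - b)].
have next h' u b w u' : history (rcons h' (u, b)) ->
    prefix (rcons h (v, a)) (rcons h' (u, b)) -> ~ bounded_win u ->
    (u \in vertices1 G -> (u, w, u') = sigma (rcons h' (u, b))) ->
    (u, w, u') \in edges G -> before (u', b + w) \/ after (u', b + w).
  move=> hist' pre nwinu sig e; have [win'|nwin'] := pselect (bounded_win u').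
    right; have [Q [safeQ boundQ Qu']] := BP _ win'; exists (b + w), Q.
    split=> //; last by rewrite subrr.
    rewrite (leq_trans (vnormD _ _))// leq_add ?(vnorm_edge e)// leqNgt.
    by apply/negP => bR; apply: nesc; exists h', (u, b).
  left; exists (rcons h' (u, b)); split=> //; first exact: history_extend.
  by apply: prefix_trans pre _; apply: prefix_rcons.
(* Translating by [a] brings [(v, a)] to [(v, 0)] and adds [vnorm a] to the bound. *)
exists (R + enorm G + B + vnorm a)%N,
  (fun c => before (c.1, c.2 + a) \/ after (c.1, c.2 + a)).
split.
- apply: (@safe_translate (fun c => before c \/ after c)) => u b.
  case=> [[h' [hist' pre nwinu]]|[b' [Q [b'R safeQ boundQ Qu]]]].
    split=> [u1|u2 w u' e]; last first.
      by apply: next hist' pre nwinu _ e => u1; rewrite u1 in u2.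
    have [e e1] := sigma_strategy (history_path hist') u1.
    move: e e1 (next h' u b).
    case: (sigma _) => -[u_ w] u' e /= uE /(_ w u' hist' pre nwinu).
    rewrite uE /= in e * => next_u; exists w, u'; split=> //; exact: next_u.
  have [p1 p2] := safeQ _ _ Qu; split=> [/p1[w [u' [e Q']]]|/p2 p w u' e].
    exists w, u'; split=> //; right; exists b', Q; split=> //.
    by rewrite /= addrAC.
  by right; exists b', Q; split=> //=; rewrite addrAC; apply: p.
- move=> [u b] /= bA.
  suff : (vnorm (b + a) <= R + enorm G + B)%N.
    move=> le_ba; rewrite -[b](addrK a) (leq_trans (vnormD _ _))// vnormN.
    by rewrite leq_add2r.
  case: bA => [[h' [hist' pre nwinu]]|[b' [Q [b'R _ boundQ Qu]]]].
    rewrite -addnA (@leq_trans R) ?leq_addr// leqNgt; apply/negP => bR.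
    by apply: nesc; exists h', (u, b + a).
  rewrite -[b + a](subrK b') addrC (leq_trans (vnormD _ _))// leq_add//.
  exact: boundQ Qu.
- rewrite /= add0r; left; exists h; split=> //; first exact: prefix_refl.
Qed.

Lemma history_take h n : history h -> history (take n.+1 h).
Proof.
elim=> [|{}h c c' hist IH e sig]; first exact: History0.
have [nh|nh] := leqP n.+1 (size (rcons h c)).
  by rewrite -cats1 takel_cat.
rewrite take_oversize ?size_rcons//; first exact: HistoryS.
by move: nh; rewrite size_rcons.
Qed.

Lemma history_last h c c' : history (rcons (rcons h c) c') ->
  c.1 \in vertices1 G -> step c c' = sigma (rcons h c).
Proof.
move sE: (rcons _ c') => s hist; case: hist sE => [|h1 c1 c1' _ _ sig].
  by move=> /(congr1 size); rewrite !size_rcons.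
by move=> /rcons_inj[/rcons_inj[-> ->] ->].
Qed.

(** Otherwise [history_escape] can be iterated with growing bounds, and the limit is a play of
    infinite norm consistent with [sigma]. *)
Lemma wins_bounded :
  (forall rho, play_from v0 rho -> consistent Player1 sigma rho ->
    winning_play Player1 rho) ->
  bounded_win v0.
Proof.
move=> win; apply: contrapT => nwin.
pose bad h := history h /\ exists h' c, h = rcons h' c /\ ~ bounded_win c.1.
pose c0 : config G := (v0, 0).
have ext (hn : {h | bad h} * nat) : exists h' : {h | bad h},
    [/\ prefix (sval hn.1) (sval h'), (size (sval hn.1) < size (sval h'))%N &
        (hn.2 < vnorm (last c0 (sval h')).2)%N].
  case: hn => -[h [hist [h' [[v a] [hE nw]]]]] n /=; rewrite {}hE in hist *.
  (* Adding [vnorm a] to the bound forces the new history to be strictly longer. *)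
  have [h1 [c [hist1 pre nw1 nc]]] := history_escape (n + vnorm a) hist nw.
  have bad1 : bad (rcons h1 c) by split=> //; exists h1, c.
  exists (exist _ _ bad1); rewrite /= last_rcons; split=> //; last first.
    by rewrite (leq_ltn_trans _ nc)// leq_addr.
  have := size_prefix pre; rewrite leq_eqVlt => /predU1P[sz|//].
  move: pre; rewrite prefixE sz take_size => /eqP/rcons_inj[_ cE].
  by move: nc; rewrite cE /= ltnNge leq_addl.
have [next nextP] := choice ext.
have bad0 : bad [:: c0].
  by split; [exact: History0 | exists [::], c0].
pose F := fix F n := if n is n'.+1 then next (F n', n') else exist _ _ bad0.
pose f n := sval (F n).
have f_prefix n m : (n <= m)%N -> prefix (f n) (f m).
  move=> /subnK <-; elim: (m - n)%N => [|k IH]; first exact: prefix_refl.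
  have [pre _ _] := nextP (F (k + n)%N, (k + n)%N).
  exact: prefix_trans IH pre.
have f_size n : (n < size (f n))%N.
  elim: n => [//|n IH]; have [_ sz _] := nextP (F n, n).
  exact: leq_ltn_trans IH sz.
have f_hist n : history (f n) by rewrite /f; case: (F n) => h [].
(* The limit is well defined: [f n] has more than [n] entries, and later histories extend it. *)
pose rho n := nth c0 (f n) n.
have rhoE n m k : (k < size (f n))%N -> (n <= m)%N ->
    nth c0 (f m) k = nth c0 (f n) k.
  by move=> kn /f_prefix/prefixP[s ->]; rewrite nth_cat kn.
have rho_f n m : (n < size (f m))%N -> rho n = nth c0 (f m) n.
  move=> nm; have [le|/ltnW le] := leqP n m; first by rewrite (rhoE n m).
  by rewrite /rho (rhoE m n).
have prefixE n m : (n < size (f m))%N -> play_prefix rho n = take n.+1 (f m).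
  move=> nm; apply: (@eq_from_nth _ c0); rewrite size_mkseq ?size_takel//.
  move=> i ni.
  by rewrite nth_mkseq// nth_take// (rho_f i m)// (leq_trans ni).
have play : play_from v0 rho.
  split=> // n; rewrite (prefixE n n)//.
  by apply: history_path; apply: history_take.
have cons : consistent Player1 sigma rho.
  move=> n v1; have := history_take n.+1 (f_hist n.+1).
  by rewrite -prefixE// /play_prefix !mkseqS => /history_last; apply.
have /play_norm_lty[Bd BdP] := win _ play cons.
have [_ _] := nextP (F Bd, Bd); rewrite -[sval _]/(f Bd.+1) -nth_last.
rewrite -(rho_f (size (f Bd.+1)).-1 Bd.+1).
  by rewrite /= ltnNge BdP.
by rewrite prednK// (leq_trans _ (f_size Bd.+1)).
Qed.

End Histories.
End SafetyGames.

(** * The explicit bound *)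

(** With [n] the cycle bound, [e] the edge norm and [L] the number of directions, the left side
    bounds the coordinates in [stack_safe]. Each factor is at most a power of [4 * n], and each sum
    costs one extra power. *)
Lemma exponent_bound d n e L :
  (0 < n)%N -> (e <= n)%N -> (L <= (radius d n).*2.+1 ^ d)%N ->
  ((d * radius d n * e + L * (d * radius d n * n)) *
     (n.*2.+1 ^ d * (d * n * radius d n)) * (n.*2.+1 ^ d * (d * n * 1)) +
   (d * radius d n * e + L * (d * radius d n * n)) <=
   (4 * n) ^ (2 * (d + 2) ^ 3))%N.
Proof.
move=> n0 en Lle; set X := radius d n in Lle *; set b := (4 * n)%N.
have b4 : (4 <= b)%N by rewrite /b leq_pmulr.
have b0 : (0 < b)%N by apply: leq_trans b4.
have nb : (n <= b)%N by rewrite /b leq_pmull.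
have pw i j : (i <= j)%N -> (b ^ i <= b ^ j)%N by apply: leq_pexp2l.
have mono k i j : (i <= j)%N -> (i ^ k <= j ^ k)%N.
  by case: k => // k; rewrite leq_exp2r.
have d4 : (2 * d <= b ^ d)%N.
  apply: (@leq_trans (4 ^ d)); last exact: mono.
  elim: (d) => // k IH; rewrite expnS; lia.
have dn : (2 * d * n <= b ^ d.+1)%N by rewrite expnSr leq_mul.
have dn1 : (d * n <= b ^ d.+1)%N.
  by apply: leq_trans dn; rewrite -mulnA leq_pmull.
have Xle : (X <= b ^ (d.+1 * d))%N.
  by rewrite /X /radius expnM mono.
have C : (n.*2.+1 ^ d <= b ^ d)%N.
  by apply: mono; rewrite /b; lia.
have Lb : (L <= b ^ ((d.+1 * d).+1 * d))%N.
  apply: leq_trans Lle _; rewrite expnM mono// expnS.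
  have : (0 < b ^ (d.+1 * d))%N by rewrite expn_gt0 b0.
  by move: (b ^ _)%N Xle => y; nia.
pose m := (d.+1 * d + d.+1)%N.
have dXn : (d * X * n <= b ^ m)%N.
  by rewrite mulnAC mulnC /m expnD leq_mul.
have dXe : (d * X * e <= b ^ m)%N.
  by apply: leq_trans dXn; apply: leq_mul.
have dnX : (d * n * X <= b ^ m)%N by rewrite mulnAC.
set s := (d * X * e + L * (d * X * n))%N.
have sle : (s <= b ^ ((d.+1 * d).+1 * d + m + 1))%N.
  rewrite expnD expn1; set y := (b ^ _)%N.
  have L1 : (L.+1 <= 2 * b ^ ((d.+1 * d).+1 * d))%N.
    have : (0 < b ^ ((d.+1 * d).+1 * d))%N by rewrite expn_gt0 b0.
    by move: Lb; move: (b ^ _)%N => z; lia.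
  apply: (@leq_trans (L.+1 * b ^ m)).
    by rewrite mulSn /s leq_add// leq_mul.
  rewrite /y expnD; move: L1 b4; move: (b ^ m)%N (b ^ _)%N => z t L1 b4.
  by move: (leq_mul L1 (leqnn z)) (leq_mul (leqnn (t * z)) b4); lia.
have E1 : (n.*2.+1 ^ d * (d * n * X) <= b ^ (d + m))%N by rewrite expnD leq_mul.
have E2 : (n.*2.+1 ^ d * (d * n * 1) <= b ^ (d + d.+1))%N.
  by rewrite expnD muln1 leq_mul.
have E : (s * (n.*2.+1 ^ d * (d * n * X)) * (n.*2.+1 ^ d * (d * n * 1)) + s <=
    s * b ^ (d + m + (d + d.+1) + 1))%N.
  apply: (@leq_trans (s * (b ^ (d + m + (d + d.+1))).+1)).
    rewrite [X in (_ <= X)%N]mulnS [X in (X <= _)%N]addnC leq_add//.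
    rewrite -[X in (X <= _)%N]mulnA.
    by rewrite leq_mul// expnD leq_mul.
  rewrite leq_mul// [X in (_ <= X)%N]expnD expn1.
  have : (0 < b ^ (d + m + (d + d.+1)))%N by rewrite expn_gt0 b0.
  by move: (b ^ _)%N => y y0; apply: leq_trans (leq_mul (leqnn y) b4); lia.
apply: leq_trans E _; apply: (leq_trans (leq_mul sle (leqnn _))).
(* The total exponent is d^3 + 3 d^2 + 8 d + 5. *)
rewrite -expnD; apply: pw; rewrite /m; nia.
Qed.

Theorem lemma3p1 (d : nat) (G : game_graph d) (v0 : G)
    (enorm_gt0 : (0 < enorm G)%N) (cycles1 : cycles_meet_player1 G) :
  wins Player1 v0 ->
  exists sigma : seq (config G) -> edge G,
    winning_strategy Player1 v0 sigma /\
    forall rho : nat -> config G,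
      play_from v0 rho -> consistent Player1 sigma rho ->
      (play_norm rho <=
         (((4 * #|G| * enorm G) ^ (2 * (d + 2) ^ 3))%N%:Z)%:E)%E.
Proof.
move=> [sigma0 [strat0 win0]].
have [B [W [safeW boundW W0]]] := wins_bounded strat0 win0.
set R := ((4 * #|G| * enorm G) ^ (2 * (d + 2) ^ 3))%N.
pose n := cycle_bound G; pose X := radius d n.
have n0 : (0 < n)%N by apply: cycle_bound_gt0.
pose H := (n.*2.+1 ^ d * (d * n * X))%N%:Z%R.
have suppH u : u \in dirs d n -> (supp n u <= H)%R.
  by rewrite mem_dirs => /andP[_ uX]; apply: supp_le.
have H0 : (0 <= H)%R by [].
have boundP : bounded R (@stack_safe _ _ W B H).
  apply: stack_safe_bounded => // j.
  have e_j : (vnorm (delta_mx ord0 j : 'rV[int]_d) <= 1)%N.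
    by apply/vnormP => i; rewrite mxE; case: (_ && _).
  have slack0 : (0 <= scale G H)%R by apply: scale_ge0.
  apply: (@le_trans _ _ (scale G H * (n.*2.+1 ^ d * (d * n * 1))%N%:Z +
                     (slack G)%:Z)%R).
    by rewrite lerD2r ler_wpM2l// supp_le.
  rewrite /scale /H -!PoszM -PoszD lez_nat /R -(mulnA 4 #|G|).
  apply: exponent_bound => //; last exact: size_dirs.
  by rewrite leq_pmull//; apply/card_gt0P; exists v0.
have [sigma [strat sigmaP]] := safe_strategy
  (stack_safe_safe safeW boundW enorm_gt0 suppH)
  (stack_safe_init B W0 H0).
have norm_le rho : play_from v0 rho -> consistent Player1 sigma rho ->
    (play_norm rho <= (R%:Z)%:E)%E.
  by move=> play cons; apply/play_norm_le => k; apply/boundP/sigmaP.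
exists sigma; split=> //; split=> // rho play cons.
exact: le_lt_trans (norm_le _ play cons) (ltry _).
Qed.
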